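(* Consider $N=2$ files, $K=2$ users, subpacketization $2$ and cache size $M=1$. Then rate $R=1/2$ cannot be achieved with demand privacy using a linear scheme; i.e. there is no linear demand-private coded caching scheme (over any finite field) with these parameters.
   Context: Linear scheme with $2$ users, $2$ files $A,B$ and subpacketization $f$: each file is split into $f$ equal-size subfiles $A_0,\dots,A_{f-1}$, $B_0,\dots,B_{f-1}$, regarded as independent uniform symbols (or vectors of symbols) over a finite field $\mathbb F$; put $S=(A_0,\dots,A_{f-1},B_0,\dots,B_{f-1})^T$. Placement phase: the server gives User $i\in\{0,1\}$ the cache $Z_i=\mathsf C_iS$, where $\mathsf C_i$ is an $fM\times 2f$ matrix over $\mathbb F$ ($M$ is the cache size in files). The pair $(\mathsf C_0,\mathsf C_1)$ may be chosen at random according to a publicly known distribution; the realized $\mathsf C_i$ (the header $\Theta(Z_i)$) is known only to the server and User $i$. Delivery phase: the demands $D_0,D_1$ are i.i.d. uniform on $\{A,B\}$, independent of the files and of $(\mathsf C_0,\mathsf C_1)$, and are sent privately to the server. Depending on $(\mathsf C_0,\mathsf C_1,D_0,D_1)$ (possibly with additional randomness), the server chooses an $fR\times 2f$ matrix $T$ over $\mathbb F$ and multicasts $X=TS$ together with the header $\Theta(X)=T$ ($R$ is the rate). Decodability: for every realization, User $i$ can recover all subfiles of file $D_i$ as linear combinations of the entries of $Z_i$ and $X$. Demand privacy: $I(D_i,Z_i,\Theta(Z_i),X,\Theta(X);D_j)=0$ for $i\neq j$. Here $f=2$, $M=1$, $R=1/2$, so $\mathsf C_i$ is $2\times4$ and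 $T$ is $1\times 4$. *)

(* Defs.v *)
From HB Require Import structures.
From mathcomp Require Import all_boot all_order all_algebra.
From mathcomp Require Import reals exp.

Set Implicit Arguments.
Unset Strict Implicit.
Unset Printing Implicit Defensive.

Import Order.TTheory GRing.Theory Num.Theory.
Local Open Scope ring_scope.

Record pmf (R : realType) (T : finType) := Pmf {
  pmf_fun :> T -> R;
  pmf_ge0 : forall x, 0 <= pmf_fun x;
  pmf_sum1 : \sum_x pmf_fun x = 1
}.

Definition prob (R : realType) (W : finType) (law : W -> R) (E : pred W) : R :=
  \sum_(w | E w) law w.

(* I(X; Y), in nats.  Terms with P(X = x, Y = y) = 0 vanish because of the
   leading factor, as in the usual convention 0 log 0 = 0. *)
Definition mutual_info (R : realType) (W A B : finType) (law : W -> R)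
    (X : W -> A) (Y : W -> B) : R :=
  \sum_(x : A) \sum_(y : B)
    prob law [pred w | (X w == x) && (Y w == y)] *
    ln (prob law [pred w | (X w == x) && (Y w == y)] /
        (prob law [pred w | X w == x] * prob law [pred w | Y w == y])).

Definition user := 'I_2.

(* The two files: [false] is A, [true] is B. *)
Definition file := bool.

Definition demands := {ffun user -> file}.

(* A library is the column
   (A_0, ..., A_(f-1), B_0, ..., B_(f-1))^T; each subfile is a row, that is, a
   vector of L symbols of F. *)
Definition library (F : finFieldType) (f L : nat) := 'M[F]_(f + f, L).

Definition subfiles (F : finFieldType) (f L : nat) (d : file)
    (S : library F f L) : 'M[F]_(f, L) :=
  if d then dsubmx S else usubmx S.

(* The matrices (C_0, C_1), with m = f M rows each. *)
Definition caching (F : finFieldType) (f m : nat) :=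
  {ffun user -> 'M[F]_(m, f + f)}.

(* [placement] is the joint law of (C_0, C_1); [delivery C D] is the conditional
   law of the r x 2f matrix T given the caching matrices and the demands.
   Arbitrary additional server randomness, independent of the files, enters only
   through this conditional law. *)
Record linear_scheme (R : realType) (F : finFieldType) (f m r : nat) :=
  LinearScheme {
    placement : pmf R (caching F f m);
    delivery : caching F f m -> demands -> pmf R 'M[F]_(r, f + f)
  }.

Section Scheme.
Variables (R : realType) (F : finFieldType) (f m r L : nat).
Variable sch : linear_scheme R F f m r.

Definition outcome : finType :=
  (caching F f m * demands * 'M[F]_(r, f + f) * library F f L)%type.

Definition out_C (w : outcome) : caching F f m := w.1.1.1.
Definition out_D (w : outcome) : demands := w.1.1.2.
Definition out_T (w : outcome) : 'M[F]_(r, f + f) := w.1.2.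
Definition out_S (w : outcome) : library F f L := w.2.

(* The subfiles are independent and uniform, the demands are i.i.d. uniform, and
   files, demands and caching matrices are mutually independent. *)
Definition joint_law (w : outcome) : R :=
  placement sch (out_C w) *
  (\prod_(i : user) #|{: file}|%:R^-1) *
  delivery sch (out_C w) (out_D w) (out_T w) *
  #|{: library F f L}|%:R^-1.

(* The decoding matrix G is chosen before S: its coefficients do not depend on
   the contents of the files. *)
Definition decodable : Prop :=
  forall (C : caching F f m) (D : demands) (T : 'M[F]_(r, f + f)),
    0 < placement sch C -> 0 < delivery sch C D T ->
    forall i : user, exists G : 'M[F]_(f, m + r),
      forall S : library F f L,
        subfiles (D i) S = G *m col_mx (C i *m S) (T *m S).

(* (D_i, Z_i, Theta(Z_i), X, Theta(X)) *)
Definition view (i : user) (w : outcome) :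
    file * 'M[F]_(m, L) * 'M[F]_(m, f + f) * 'M[F]_(r, L) * 'M[F]_(r, f + f) :=
  (out_D w i, out_C w i *m out_S w, out_C w i, out_T w *m out_S w, out_T w).

Definition demand_private : Prop :=
  forall i j : user, i != j ->
    mutual_info joint_law (view i) (fun w => out_D w j) = 0.

End Scheme.

(* Some demand-private linear scheme over F with subpacketization f has cache
   size M and rate rho, both measured in files. *)
Definition private_linear_achievable (R : realType) (F : finFieldType)
    (f : nat) (M rho : rat) : Prop :=
  exists (m r L : nat) (sch : linear_scheme R F f m r),
    [/\ m%:R = f%:R * M, r%:R = f%:R * rho, (0 < L)%N,
        decodable L sch & demand_private L sch].

(* Main.v *)
(* Write each row vector as a pair (file-A half, file-B half).  A user decoding
   one file from 3 equations in 4 unknowns must have the halves belonging to the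
   other file span at most a line.  Since each cache must serve both demands,
   its A half and its B half are lines, and T's half on an undesired file lies
   in that user's line.  For demands (A, B), user 1 needs the B half of T to
   complete its own B line to the plane; so that half is nonzero, and, lying in
   the B line of user 0, it shows that the two B lines are distinct.  For
   demands (A, A), the B half of T lies in both B lines, so it vanishes.  Hence
   T reveals to user 0 whether D_1 = A or D_1 = B. *)
Require Import Defs.
From mathcomp Require Import all_boot all_order all_algebra.
From mathcomp Require Import reals exp.
From mathcomp Require Import lra.

Set Implicit Arguments.
Unset Strict Implicit.
Unset Printing Implicit Defensive.

Import Order.TTheory GRing.Theory Num.Theory.
Local Open Scope ring_scope.

(** * Gibbs' inequality and supports of independent variables *)

(** The tangent bound [ln t <= t - 1] at [t = q / p], multiplied by [p]; for [p = 0] the logarithmic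
    term vanishes. *)
Lemma mulr_ln_divr_ge (R : realType) (p q : R) :
  0 <= p -> 0 <= q -> (q = 0 -> p = 0) -> p - q <= p * ln (p / q).
Proof.
rewrite le_eqVlt => /predU1P[<-|p0] q0 pq; first by rewrite mul0r sub0r oppr_le0.
have {pq}q0 : 0 < q.
  by rewrite lt_neqAle q0 eq_sym andbT; apply/eqP => /pq E; rewrite E ltxx in p0.
have qp0 : 0 < q / p by rewrite divr_gt0.
have : ln (q / p) <= q / p - 1.
  by rewrite -[X in ln X](subrKC 1) le_ln1Dx //; lra.
rewrite -[q / p]invf_div lnV ?posrE ?divr_gt0 // => /(ler_wpM2l (ltW p0)).
rewrite invf_div mulrBr mulr1 mulrCA divff ?gt_eqF // mulr1 mulrN; lra.
Qed.

Lemma sum_prob_fiber (R : realType) (W A : finType) (law : W -> R)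
    (X : W -> A) (E : pred W) :
  \sum_x prob law [pred w | (X w == x) && E w] = prob law E.
Proof.
rewrite /prob [RHS](partition_big X predT) //=; apply: eq_bigr => x _.
by apply: eq_bigl => w /=; rewrite andbC.
Qed.

Lemma le_prob (R : realType) (W : finType) (law : W -> R) (E E' : pred W) :
  (forall w, 0 <= law w) -> (forall w, E w -> E' w) ->
  prob law E <= prob law E'.
Proof.
move=> law0 EE'; rewrite /prob big_mkcond [leRHS]big_mkcond ler_sum // => w _.
by case: ifP => [/EE' ->//|_]; case: ifP.
Qed.

(* Gibbs' inequality holds term by term after subtracting p - q, and the
   corrections p - q sum to zero; so no term can have p = 0 < q. *)
Lemma mutual_info_eq0_support (R : realType) (W A B : finType) (law : W -> R)
    (X : W -> A) (Y : W -> B) (x : A) (y : B) :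
  (forall w, 0 <= law w) -> \sum_w law w = 1 -> mutual_info law X Y = 0 ->
  0 < prob law [pred w | X w == x] -> 0 < prob law [pred w | Y w == y] ->
  0 < prob law [pred w | (X w == x) && (Y w == y)].
Proof.
move=> law0 law1; rewrite /mutual_info.
set pX := fun x => prob law [pred w | X w == x].
set pY := fun y => prob law [pred w | Y w == y].
set pXY := fun x y => prob law [pred w | (X w == x) && (Y w == y)].
rewrite -/(pX x) -/(pY y) -/(pXY x y) => MI0 px py.
have prob_ge0 E : 0 <= prob law E by apply: sumr_ge0.
have term_ge x' y' :
    pXY x' y' - pX x' * pY y' <= pXY x' y' * ln (pXY x' y' / (pX x' * pY y')).
  apply: mulr_ln_divr_ge; rewrite ?mulr_ge0 ?prob_ge0 // => /eqP.
  rewrite mulf_eq0 => /orP[]/eqP p0; apply/eqP; rewrite eq_le prob_ge0 andbT -p0.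
    by apply: le_prob => // w /= /andP[].
  by apply: le_prob => // w /= /andP[].
have sumX : \sum_x' pX x' = 1.
  rewrite -law1 -[RHS](sum_prob_fiber law X xpredT).
  by apply: eq_bigr => x' _; apply: eq_bigl => w /=; rewrite andbT.
have sumY : \sum_y' pY y' = 1.
  rewrite -law1 -[RHS](sum_prob_fiber law Y xpredT).
  by apply: eq_bigr => y' _; apply: eq_bigl => w /=; rewrite andbT.
have sumXY : \sum_x' \sum_y' pXY x' y' = 1.
  rewrite exchange_big -sumY; apply: eq_bigr => y' _; exact: sum_prob_fiber.
pose gap x' y' := pXY x' y' * ln (pXY x' y' / (pX x' * pY y'))
                  - (pXY x' y' - pX x' * pY y').
have gap_ge0 x' y' : 0 <= gap x' y' by rewrite subr_ge0.
have gap_sum : \sum_x' \sum_y' gap x' y' = 0.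
  under eq_bigr do rewrite sumrB sumrB -mulr_sumr sumY mulr1.
  by rewrite sumrB MI0 sumrB sumXY sumX subrr subr0.
have /psumr_eq0P/(_ y isT) : \sum_y' gap x y' = 0.
  by apply: (psumr_eq0P _ gap_sum) => // x' _; apply: sumr_ge0.
move=> /(_ (fun y' _ => gap_ge0 x y')) gap0.
rewrite lt_neqAle prob_ge0 andbT eq_sym; apply/eqP => pxy0.
by move: gap0; rewrite /gap pxy0 !mul0r !sub0r opprK; have := mulr_gt0 px py; lra.
Qed.

(** * Linear algebra of decoding *)

(** The column split of coefficient matrices that matches the row split of libraries in
    [subfiles]. *)
Definition file_part (F : finFieldType) (f k : nat) (d : file)
    (K : 'M[F]_(k, f + f)) : 'M[F]_(k, f) :=
  if d then rsubmx K else lsubmx K.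

(** Decodability with the library eliminated: [G] reproduces the file [d] and cancels the other
    one. *)
Definition decodes (F : finFieldType) (f m r : nat) (d : file)
    (C : 'M[F]_(m, f + f)) (T : 'M[F]_(r, f + f)) : Prop :=
  exists G : 'M[F]_(f, m + r), forall d' : file,
    G *m col_mx (file_part d' C) (file_part d' T) = (d' == d)%:R%:M.

(** A library with a single 1, in row [j], reads off column [j] of each matrix; [0 < L] leaves room
    for that entry. *)
Lemma mulmxl_inj (F : fieldType) (k n L : nat) (K K' : 'M[F]_(k, n)) :
  (0 < L)%N -> (forall S : 'M[F]_(n, L), K *m S = K' *m S) -> K = K'.
Proof.
case: L => // L _ KK'; apply/matrixP => i j.
have /matrixP/(_ i ord0) := KK' (delta_mx j ord0).
by rewrite -(mul_delta_mx (0 : 'I_1)) !mulmxA -!colE !mxE !big_ord1 !mxE !eqxx !mulr1.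
Qed.

Lemma decodable_decodes (R : realType) (F : finFieldType) (f m r L : nat)
    (sch : linear_scheme R F f m r) (C : caching F f m) (D : demands)
    (T : 'M[F]_(r, f + f)) (i : user) :
  (0 < L)%N -> decodable L sch ->
  0 < placement sch C -> 0 < delivery sch C D T -> decodes (D i) (C i) T.
Proof.
move=> L0 dec pC pT; have [G GP] := dec C D T pC pT i; exists G => d'.
have -> : col_mx (file_part d' (C i)) (file_part d' T)
          = file_part d' (col_mx (C i) T).
  rewrite /file_part; apply/matrixP => k j.
  by case: d'; rewrite !mxE; case: split => ?; rewrite !mxE.
(* The block row on the left extracts the file [D i] from a library. *)
have E : (if D i then row_mx 0 1%:M else row_mx 1%:M 0) = G *m col_mx (C i) T.
  apply: (@mulmxl_inj _ _ _ L) => // S.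
  rewrite -mulmxA mul_col_mx -GP /subfiles -{1}(vsubmxK S).
  by case: (D i); rewrite mul_row_col mul1mx mul0mx ?add0r ?addr0.
by case: d'; rewrite /file_part ?mulmx_rsub ?mulmx_lsub -E;
  case: (D i); rewrite ?row_mxKr ?row_mxKl // -scalemx1 scale0r.
Qed.

Section Decoding.
Variables (F : finFieldType) (f m r : nat) (d : file).
Variables (C : 'M[F]_(m, f + f)) (T : 'M[F]_(r, f + f)).
Hypothesis decCT : decodes d C T.

Lemma decodes_rank : \rank (col_mx (file_part d C) (file_part d T)) = f.
Proof.
have [G GP] := decCT; apply/eqP/row_fullP; exists G.
by rewrite GP eqxx.
Qed.

(** [G] has rank [f], since its product with the desired half is the identity, and it annihilates
    the other half; rank-nullity bounds the latter. *)
Lemma decodes_interference_rank :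
  (\rank (col_mx (file_part (~~ d) C) (file_part (~~ d) T))
     <= m + r - f)%N.
Proof.
have [G GP] := decCT.
have rG : \rank G = f.
  apply/eqP; rewrite eqn_leq rank_leq_row /=.
  rewrite -[X in (X <= _)%N](@mxrank1 F f) -[1%:M]/(true%:R%:M) -(eqxx d) -GP.
  exact: mxrankM_maxl.
rewrite -[leqLHS](addKn f) leq_sub2r // -{1}rG mulmx0_rank_max // GP.
by case: (d) => /=; rewrite -scalemx1 scale0r.
Qed.

End Decoding.

(** When the other file is demanded, this half is interference, of rank at most 2 + 1 - 2. When [d]
    is demanded, the half must reach rank 2 with the help of a single row. *)
Lemma cache_part_rank (F : finFieldType) (C : 'M[F]_(2, 2 + 2))
    (TA TB : 'M[F]_(1, 2 + 2)) (d : file) :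
  decodes false C TA -> decodes true C TB ->
  \rank (file_part d C) = 1%N.
Proof.
move=> dA dB; apply/eqP; rewrite eqn_leq; apply/andP; split.
  have {dA dB} [T /decodes_interference_rank] :
    exists T : 'M[F]_(1, 2 + 2), decodes (~~ d) C T.
    by case: d; [exists TA | exists TB].
  rewrite negbK -addsmxE; apply: leq_trans.
  exact: mxrankS (addsmxSl _ _).
have {dA dB} [T /decodes_rank] : exists T : 'M[F]_(1, 2 + 2), decodes d C T.
  by case: d; [exists TB | exists TA].
rewrite -addsmxE => rk; rewrite -(leq_add2r 1) -[X in (X <= _)%N]rk.
apply: leq_trans (mxrank_adds_leqif _ _) _.
by rewrite leq_add2l rank_leq_row.
Qed.

(** Stacking the row of [T] under the cache half cannot raise the rank above 1, so it does not
    enlarge the row space. *)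
Lemma interference_sub_cache (F : finFieldType) (d : file)
    (C : 'M[F]_(2, 2 + 2)) (T : 'M[F]_(1, 2 + 2)) :
  decodes d C T -> \rank (file_part (~~ d) C) = 1%N ->
  (file_part (~~ d) T <= file_part (~~ d) C)%MS.
Proof.
move=> /decodes_interference_rank; rewrite -addsmxE => rk C1.
apply: submx_trans (addsmxSr (file_part (~~ d) C) _) _.
rewrite -(mxrank_leqif_sup (addsmxSl _ _)) eqn_leq C1 rk andbT.
by rewrite -[leqLHS]C1 mxrankS ?addsmxSl.
Qed.

Lemma rank1_eqmx (F : fieldType) (m n : nat) (A : 'M[F]_(m, n)) (t : 'rV[F]_n) :
  \rank A = 1%N -> (t <= A)%MS -> t != 0 -> (t :=: A)%MS.
Proof.
move=> A1 tA t0; apply/eqmxP.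
by rewrite tA /= -(geq_leqif (mxrank_leqif_sup tA)) A1 rank_rV t0.
Qed.

(** * Support and total mass of the joint law *)

Lemma pmf_pos (R : realType) (T : finType) (p : pmf R T) : exists x, 0 < p x.
Proof.
apply/existsP; apply: contraT; rewrite negb_exists => /forallP p0.
have := pmf_sum1 p; rewrite big1 => [/eqP|x _]; first by rewrite eq_sym oner_eq0.
by apply/eqP; rewrite eq_le pmf_ge0 andbT leNgt p0.
Qed.

Section JointLaw.
Variables (R : realType) (F : finFieldType) (f m r L : nat).
Variable sch : linear_scheme R F f m r.

Lemma joint_law_ge0 (w : outcome F f m r L) : 0 <= joint_law sch w.
Proof. by rewrite !mulr_ge0 ?pmf_ge0 ?prodr_ge0 // => *; rewrite invr_ge0. Qed.

(** The demand and library factors are positive constants. *)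
Lemma joint_law_gt0 (w : outcome F f m r L) :
  (0 < joint_law sch w) =
  (0 < placement sch (out_C w)) && (0 < delivery sch (out_C w) (out_D w) (out_T w)).
Proof.
have L0 : 0 < #|{: library F f L}|%:R^-1 :> R.
  by rewrite invr_gt0 ltr0n; apply/card_gt0P; exists 0.
have D0 : 0 < \prod_(i : user) #|{: file}|%:R^-1 :> R.
  by apply: prodr_gt0 => i _; rewrite card_bool invr_gt0.
rewrite /joint_law pmulr_lgt0 //.
rewrite !lt_neqAle !mulr_ge0 ?pmf_ge0 ?(ltW D0) // !andbT.
by rewrite ![_ == _ * _]eq_sym !mulf_eq0 (gt_eqF D0) orbF negb_or ![_ == 0]eq_sym.
Qed.

Lemma sum_joint_law : \sum_(w : outcome F f m r L) joint_law sch w = 1.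
Proof.
pose u : R := \prod_(i : user) #|{: file}|%:R^-1.
pose v : R := #|{: library F f L}|%:R^-1.
(* Each factor sums to 1 once the choices before it are fixed, so the sums collapse from the
   innermost outwards. *)
transitivity (\sum_C \sum_D \sum_T \sum_(S : library F f L)
  placement sch C * u * delivery sch C D T * v).
  by rewrite !pair_bigA; apply: eq_bigr => -[[[]]].
have sumv : \sum_(S : library F f L) v = 1.
  rewrite sumr_const -[v *+ _]mulr_natr mulVf // pnatr_eq0 -lt0n.
  by apply/card_gt0P; exists 0.
have sumu : \sum_(D : demands) u = 1.
  rewrite sumr_const card_ffun /u prodr_const -[_ *+ _]mulr_natr natrX.
  by rewrite -exprMn mulVf ?expr1n // card_bool pnatr_eq0.
under eq_bigr => C _ do under eq_bigr => D _ do
  (under eq_bigr => T _ do rewrite -mulr_sumr sumv mulr1;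
   rewrite -mulr_sumr pmf_sum1 mulr1).
by under eq_bigr => C _ do rewrite -mulr_sumr sumu mulr1; rewrite pmf_sum1.
Qed.

End JointLaw.

(** * The transmission reveals the other demand *)

Definition demand_pair (a b : file) : demands :=
  [ffun i : user => if i == ord0 then a else b].

Lemma not_private_decodable (R : realType) (F : finFieldType) (L : nat)
    (sch : linear_scheme R F 2 2 1) :
  (0 < L)%N -> decodable L sch -> demand_private L sch -> False.
Proof.
move=> L0 dec priv.
have dec0 C a b T : 0 < placement sch C -> 0 < delivery sch C (demand_pair a b) T ->
    decodes a (C ord0) T.
  by move=> pC pT; have := decodable_decodes ord0 L0 dec pC pT; rewrite ffunE.
have dec1 C a b T : 0 < placement sch C -> 0 < delivery sch C (demand_pair a b) T ->
    decodes b (C ord_max) T.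
  by move=> pC pT; have := decodable_decodes ord_max L0 dec pC pT; rewrite ffunE.
have rk0 C d : 0 < placement sch C -> \rank (file_part d (C ord0)) = 1%N.
  move=> pC.
  have [TA pA] := pmf_pos (delivery sch C (demand_pair false false)).
  have [TB pB] := pmf_pos (delivery sch C (demand_pair true false)).
  exact: cache_part_rank (dec0 _ _ _ _ pC pA) (dec0 _ _ _ _ pC pB).
have rk1 C d : 0 < placement sch C -> \rank (file_part d (C ord_max)) = 1%N.
  move=> pC.
  have [TA pA] := pmf_pos (delivery sch C (demand_pair false false)).
  have [TB pB] := pmf_pos (delivery sch C (demand_pair false true)).
  exact: cache_part_rank (dec1 _ _ _ _ pC pA) (dec1 _ _ _ _ pC pB).
have TB_neq0 C T : 0 < placement sch C ->
    0 < delivery sch C (demand_pair false true) T -> file_part true T != 0.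
  move=> pC pT; apply/eqP => T0; have := decodes_rank (dec1 _ _ _ _ pC pT).
  by rewrite T0 rank_col_mx0 rk1.
have TB_eq0 C T : 0 < placement sch C ->
    0 < delivery sch C (demand_pair false false) T -> file_part true T = 0.
  move=> pC pT; apply/eqP; apply: contraT => T0.
  (* A nonzero B half of [T] would span the B lines of both caches. For demands (A, B), the B half
     of any [T'] lies in the line of user 0, so user 1 would see only that one line where rank 2 is
     required. *)
  have T0P := rank1_eqmx (rk0 C true pC)
    (interference_sub_cache (dec0 _ _ _ _ pC pT) (rk0 C true pC)) T0.
  have T1P := rank1_eqmx (rk1 C true pC)
    (interference_sub_cache (dec1 _ _ _ _ pC pT) (rk1 C true pC)) T0.
  have [T' pT'] := pmf_pos (delivery sch C (demand_pair false true)).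
  have := decodes_rank (dec1 _ _ _ _ pC pT').
  have : (col_mx (file_part true (C ord_max)) (file_part true T')
            <= file_part true T)%MS.
    rewrite col_mx_sub T1P submx_refl T0P.
    exact: interference_sub_cache (dec0 _ _ _ _ pC pT') (rk0 C true pC).
  by move/mxrankS; rewrite rank_rV T0 => + rk2; rewrite rk2.
have [C pC] := pmf_pos (placement sch).
have [T pT] := pmf_pos (delivery sch C (demand_pair false false)).
have [T' pT'] := pmf_pos (delivery sch C (demand_pair false true)).
(* Any library would do, as all have the same positive mass. *)
pose w : outcome F 2 2 1 L := (C, demand_pair false false, T, 0).
pose w' : outcome F 2 2 1 L := (C, demand_pair false true, T', 0).
have prob_gt0 (E : pred (outcome F 2 2 1 L)) z :
    0 < joint_law sch z -> E z -> 0 < prob (joint_law sch) E.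
  move=> pz Ez; rewrite /prob (bigD1 z) //= ltr_wpDr // sumr_ge0 // => *.
  exact: joint_law_ge0.
have px : 0 < prob (joint_law sch) [pred z | view ord0 z == view ord0 w].
  by apply: (prob_gt0 _ w); rewrite ?joint_law_gt0 ?pC //= eqxx.
have py : 0 < prob (joint_law sch) [pred z : outcome F 2 2 1 L | out_D z ord_max == true].
  by apply: (prob_gt0 _ w'); rewrite ?joint_law_gt0 ?pC //= ffunE.
have := mutual_info_eq0_support (@joint_law_ge0 _ _ _ _ _ _ sch)
  (sum_joint_law L sch) (priv ord0 ord_max isT) px py.
rewrite /prob => pxy.
(* Privacy makes the view from demands (A, A) compatible with [D_1] = B. The view fixes only user
   0's cache matrix, so [C1] may differ from [C] at user 1; [TB_neq0] and [TB_eq0] therefore hold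
   for every placement of positive mass. *)
have /existsP[[[[C1 D1] T1] S1] /andP[/andP[/eqP[D10 _ _ _ T1T] /eqP D11]]] :
    [exists z, (view ord0 z == view ord0 w) && (out_D z ord_max == true)
                 && (0 < joint_law sch z)].
  apply: contraT; rewrite negb_exists => /forallP no.
  move: pxy; rewrite big1 ?ltxx // => z /= Ez.
  by have := no z; rewrite Ez /= -leNgt => le0; apply/eqP; rewrite eq_le le0 joint_law_ge0.
have D1E : D1 = demand_pair false true.
  apply/ffunP => i; rewrite [RHS]ffunE; case: ifP => [/eqP->|].
    by rewrite [LHS]D10 ffunE.
  by case: i => -[|[|]] // i2 _; rewrite -[RHS]D11; congr (D1 _); apply: val_inj.
have {}T1T : T1 = T := T1T.
rewrite joint_law_gt0 /= D1E T1T => /andP[pC1 pT1].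
by have := TB_neq0 _ _ pC1 pT1; rewrite (TB_eq0 _ _ pC pT) eqxx.
Qed.

Theorem lemma3 (R : realType) (F : finFieldType) :
  ~ private_linear_achievable R F 2 1 (1 / 2).
Proof.
move=> [m [r [L [sch [mE rE L0 dec priv]]]]].
have m2 : m = 2%N by apply/eqP; rewrite -(eqr_nat rat) mE mulr1.
have r1 : r = 1%N by apply/eqP; rewrite -(eqr_nat rat) rE.
by subst m r; exact: (not_private_decodable L0 dec priv).
Qed.
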